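(* Let $p\geq 19$ be a prime and let $G=PSL(2,p)=SL(2,p)/\{\pm I\}$, where $SL(2,p)$ is the group of all $2\times 2$ matrices of determinant $1$ over $\mathbb{Z}_p$. Then the Cayley graph of $G$ with respect to the generating set consisting of the cosets of the matrices \[x=\begin{bmatrix}1&1\\0&1\end{bmatrix}\quad\text{and}\quad y=\begin{bmatrix}1&0\\1&1\end{bmatrix}\] is a Černý Cayley graph.
   Context: For a finite set $X$, $T_X$ is the set of all maps $X\to X$, acting on the right of $X$. An automaton with state set $X$ is a subset $\Sigma\subseteq T_X$, written $(X,\Sigma)$. The free monoid $\Sigma^*$ acts on the right of $X$ via the homomorphism $\Sigma^*\to T_X$ extending the inclusion $\Sigma\hookrightarrow T_X$. A word $w\in\Sigma^*$ is synchronizing if $|Xw|=1$; the automaton is synchronizing if it admits a synchronizing word. If $G$ is a finite group with generating set $\Delta$, elements of $\Delta$ are identified with the right translations $g\mapsto gd$ of $G$, so $\Delta\subseteq T_G$; the automaton $(G,\Delta)$ is the Cayley graph of $G$ with respect to $\Delta$. $(G,\Delta)$ is a Černý Cayley graph if every synchronizing automaton $(G,\Sigma)$ with $\Delta\subseteq\Sigma\subseteq T_G$ admits a synchronizing word of length at most $(|G|-1)^2$. *)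

(* Defs.v *)
From HB Require Import structures.
From mathcomp Require Import all_boot all_order all_algebra all_fingroup.

Set Implicit Arguments.
Unset Strict Implicit.
Unset Printing Implicit Defensive.

Import GroupScope GRing.Theory.

Section Automata.

Variable X : finType.
Implicit Types (Sigma : {set {ffun X -> X}}) (w : seq {ffun X -> X}).

(* Maps act on the right, so the first letter of a word is applied first. *)
Definition word_act (x : X) w : X := foldl (fun z (f : {ffun X -> X}) => f z) x w.

Definition word_over Sigma w : bool := all (mem Sigma) w.

Definition synchronizing_word Sigma w : bool :=
  word_over Sigma w && (#|[set word_act x w | x : X]| == 1%N).

Definition synchronizing Sigma : Prop :=
  exists w, synchronizing_word Sigma w.

End Automata.

Section CayleyGraphs.

Variable gT : finGroupType.
Implicit Types Delta : {set gT}.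

Definition right_translation (d : gT) : {ffun gT -> gT} :=
  [ffun g => g * d].

Definition cayley_graph Delta : {set {ffun gT -> gT}} :=
  right_translation @: Delta.

(* To be used together with <<Delta>> = [set: gT]: the notion is only meant
   for generating sets. *)
Definition cerny_cayley_graph Delta : Prop :=
  forall Sigma : {set {ffun gT -> gT}},
    cayley_graph Delta \subset Sigma -> synchronizing Sigma ->
  exists w, synchronizing_word Sigma w /\ (size w <= (#|gT| - 1) ^ 2)%N.

End CayleyGraphs.

Section PSL2.

Variable p : nat.

Definition SL2 : {set {'GL_2(p)}} := [set u : {'GL_2(p)} | \det (GLval u) == 1]%R.

Lemma SL2_group_set : group_set SL2.
Proof.
apply/group_setP; split=> [|u v]; first by rewrite inE GL_1E det1.
rewrite !inE GL_ME => /eqP du /eqP dv.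
by rewrite det_mulmx du dv mulr1.
Qed.

Canonical SL2_group := Group SL2_group_set.

Definition pmI : {set {'GL_2(p)}} :=
  [set u : {'GL_2(p)} | (GLval u == 1%R) || (GLval u == (- 1)%R)].

Lemma pmI_group_set : group_set pmI.
Proof.
apply/group_setP; split=> [|u v]; first by rewrite inE GL_1E eqxx.
rewrite !inE GL_ME => /orP[]/eqP-> /orP[]/eqP->;
  by rewrite ?mulrNN ?mul1r ?mulr1 eqxx ?orbT.
Qed.

Canonical pmI_group := Group pmI_group_set.

Lemma pmI_normal : pmI <| SL2.
Proof.
apply/andP; split.
  apply/subsetP=> u; rewrite !inE => /orP[]/eqP->; first by rewrite det1.
  by rewrite -scaleN1r detZ det1 mulr1 -signr_odd.
apply/cents_norm/centsP=> u _ v; rewrite inE => hv.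
apply/val_inj; rewrite -[LHS]/(GLval u * GLval v)%R -[RHS]/(GLval v * GLval u)%R.
by case/orP: hv => /eqP->; rewrite ?mulr1 ?mul1r ?mulrN1 ?mulN1r.
Qed.

(* The quotient as a type, so that it can serve as the state set of an
   automaton. *)
Definition PSL2 : finGroupType := subg_of (SL2 / pmI)%G.

(* Only meaningful for u \in SL2; elsewhere subg returns the identity. *)
Definition PSL2_coset (u : {'GL_2(p)}) : PSL2 := subg (SL2 / pmI)%G (coset pmI u).

Definition mx22 (a b c d : 'F_p) : 'M['F_p]_2 :=
  \matrix_(i, j) (if i == 0%R then if j == 0%R then a else b
                  else if j == 0%R then c else d).

Lemma mx22_det a b c d : (\det (mx22 a b c d) = a * d - b * c)%R.
Proof.
rewrite (expand_det_row _ ord0) !big_ord_recl big_ord0 addr0 /cofactor.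
by rewrite !det_mx11 !mxE /= expr0 expr1 !mulN1r mul1r mulrN.
Qed.

Lemma SL2x_unit : mx22 1%R 1%R 0%R 1%R \is a GRing.unit.
Proof.
by rewrite -[_ \is a _]/(_ \in unitmx) unitmxE mx22_det mulr1 mulr0 subr0 unitr1.
Qed.

Lemma SL2y_unit : mx22 1%R 0%R 1%R 1%R \is a GRing.unit.
Proof.
by rewrite -[_ \is a _]/(_ \in unitmx) unitmxE mx22_det mulr1 mul0r subr0 unitr1.
Qed.

Definition SL2x : {'GL_2(p)} := Sub (mx22 1%R 1%R 0%R 1%R) SL2x_unit.
Definition SL2y : {'GL_2(p)} := Sub (mx22 1%R 0%R 1%R 1%R) SL2y_unit.

Lemma SL2x_in : SL2x \in SL2.
Proof. by rewrite inE SubK mx22_det mulr1 mulr0 subr0. Qed.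

Lemma SL2y_in : SL2y \in SL2.
Proof. by rewrite inE SubK mx22_det mulr1 mul0r subr0. Qed.

End PSL2.

(* Main.v *)
Require Import Defs.
From mathcomp Require Import all_boot all_order all_algebra all_fingroup.
From mathcomp Require Import all_field zify ring.

Set Implicit Arguments.
Unset Strict Implicit.
Unset Printing Implicit Defensive.
Import Order.TTheory GRing.Theory Num.Theory.
Local Open Scope ring_scope.

(** Let G be a finite group of order n in which every element is a product of
    at most D generators.  A synchronizing word of length (n - 1) ^ 2 is found
    by enlarging preimages: a letter that is not injective has a fibre with at
    least two points, and it suffices that every proper nonempty subset S of G
    has a preimage larger than S under some word of length at most n, since
    then 1 + (n - 2) n letters pull a point back to the whole of G.

    Let f be the multiple n 1_S - |S| of the centred indicator of S; the goal
    is a short word w whose pull-back w f has positive sum.  If none exists,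
    averaging over G, which costs D letters, shows that the sum of w1 g w2 f
    vanishes for all g in G as soon as |w1| + |w2| + D <= n.  Hence the rational
    G-module W_j generated by the pull-backs of f under words of length at most
    j is orthogonal to the push-forwards of the uniform weight under words of
    length at most n - D - j.  Spans of words grow by one dimension per letter,
    so j < dim W_j < j + D: the increasing chain of the W_j can never jump by D
    dimensions.  A jump is forced by an element T of the group ring with an
    eigenvalue mu of degree at least D over the rationals: the kernel E of q(T),
    for q the minimal polynomial of mu, meets every submodule either trivially
    or in dimension at least deg q, and W_(n-D) is too large to avoid E.  This
    is the criterion [cerny_of_eigenvalue].

    For PSL(2, p) with the two elementary matrices, D = 3 (p - 1) will do
    ([PSL2_words]).  The operator T comes from the principal series.  Let omega
    be a primitive root of unity of order N = (p - 1) / 2, zeta one of order p.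
    The sum over the class of SL(2, p) of trace t + 1/t, with t a generator of
    the units of Z/p, acts on the principal series of the character t -> omega
    as the scalar p (omega + 1/omega) ([sum_trace_class]); followed by the
    translation by x, it has the eigenvalue p (omega + 1/omega) zeta
    ([psl_phi_eigen]).  The Galois conjugates of that number include all
    p (omega^k + omega^-k) zeta^l with k prime to N and l prime to p
    ([size_minCpoly_mu]); three values of k below N / 2 already make the degree
    at least 3 (p - 1), and they exist because p is a prime and at least 19, so
    that N >= 9 is neither 10 nor 12 ([coprime_half_units]). *)

(** * Kernels of irreducible polynomials and spans of words *)

Section LinearAlgebra.

Variable F : fieldType.

(** The intersection is a vector space over the field F[X] / (q): the vectors
    x, x T, .., x T^(deg q - 1) are independent for any nonzero x in it. *)
Lemma rank_kermxpoly_irreducible n (T : 'M[F]_n) (q : {poly F}) (W : 'M_n) :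
    irreducible_poly q -> stablemx W T -> (W :&: kermxpoly T q)%MS != 0 ->
  ((size q).-1 <= \rank (W :&: kermxpoly T q))%N.
Proof.
case: n T W => [|n] T W irr_q; first by rewrite [X in X != 0]thinmx0 eqxx.
move=> W_T /rowV0Pn[x]; rewrite sub_capmx => /andP[xW xq] x_neq0.
pose A : 'M_((size q).-1, n.+1) := \matrix_i (x *m T ^+ i).
have horA u : u *m A = x *m horner_mx T (rVpoly u).
  rewrite horner_rVpoly; apply/rowP=> j.
  rewrite mulmx_sum_row (mulmx_sum_row u) linear_sum mulmx_sumr /=.
  congr (fun_of_matrix _ _ _); apply: eq_bigr => i _.
  by rewrite linearZ /= -scalemxAr !rowK mxvecK.
have freeA : row_free A.
  apply: inj_row_free => u; rewrite horA => xu0.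
  apply/eqP/contraT => u_neq0.
  have r_neq0 : rVpoly u != 0.
    by apply: contraNneq u_neq0 => r0; rewrite -[u]rVpolyK r0 linear0.
  have cop : coprimep q (rVpoly u).
    rewrite irreducible_poly_coprime //; apply/negP=> /dvdp_leq - /(_ r_neq0).
    have [q_gt1 _] := irr_q; rewrite leqNgt (@leq_ltn_trans (size q).-1) //.
      exact: size_poly.
    by rewrite prednK // ltnW.
  case/negP: x_neq0; rewrite -submx0 -(mxdirect_kermxpoly T cop).
  by rewrite sub_capmx xq; apply/sub_kermxP.
rewrite -row_leq_rank in freeA; apply: leq_trans freeA _; apply: mxrankS.
apply/row_subP=> i; rewrite rowK sub_capmx; apply/andP; split.
  elim: (val i) => [|k IHk]; first by rewrite mulmx1.
  rewrite exprSr mulmxA; apply: submx_trans W_T; exact: submxMr.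
elim: (val i) => [|k IHk]; first by rewrite mulmx1.
have ker_T : stablemx (kermxpoly T q) T by apply: comm_mx_stable_kermxpoly.
rewrite exprSr mulmxA; apply: submx_trans ker_T; exact: submxMr.
Qed.

Lemma rank_kermxpoly n (T : 'M[F]_n) (q : {poly F}) :
    irreducible_poly q -> kermxpoly T q != 0 ->
  ((size q).-1 <= \rank (kermxpoly T q))%N.
Proof.
move=> irr_q; have /eqmxP capE : (1%:M :&: kermxpoly T q == kermxpoly T q)%MS.
  by rewrite capmxSr sub_capmx submx1 submx_refl.
rewrite -mxrank_eq0 -capE mxrank_eq0.
by apply: rank_kermxpoly_irreducible; rewrite ?mul1mx ?submx1.
Qed.

Section Krylov.

Variables (I : finType) (n : nat) (B : I -> 'M[F]_n) (P : pred I).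

Fixpoint krylov (u : 'rV[F]_n) (k : nat) : 'M[F]_n :=
  if k is k'.+1 then (krylov u k' + \sum_(i | P i) krylov u k' *m B i)%MS
  else <<u>>%MS.

Definition word_mx (s : seq I) : 'M[F]_n := foldr (fun i M => M *m B i) 1%:M s.

Lemma krylov_leS u k : (krylov u k <= krylov u k.+1)%MS.
Proof. exact: addsmxSl. Qed.

Lemma krylov_le u j k : (j <= k)%N -> (krylov u j <= krylov u k)%MS.
Proof.
elim: k => [|k IHk]; first by rewrite leqn0 => /eqP ->.
rewrite leq_eqVlt => /predU1P[-> //|/IHk le_jk].
exact: submx_trans le_jk (krylov_leS u k).
Qed.

Lemma krylov_base u k : (u <= krylov u k)%MS.
Proof. by apply: submx_trans (krylov_le u (leq0n k)); rewrite genmxE. Qed.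

(** Passing from k to k + 1 replaces the matrix C by all the B i *m C, which is
    why C has to be arbitrary. *)
Lemma krylov_mul0 u k p (C : 'M_(n, p)) :
    (forall s, all P s -> (size s <= k)%N -> u *m word_mx s *m C = 0) ->
  krylov u k *m C = 0.
Proof.
elim: k p C => [|k IHk] p C C0 /=.
  have := C0 [::] isT isT; rewrite mulmx1 => uC0.
  apply/eqP; rewrite -submx0; apply: (@submx_trans _ _ _ _ _ _ (u *m C)).
    by rewrite submxMr // genmxE.
  by rewrite uC0 sub0mx.
apply/sub_kermxP; rewrite addsmx_sub; apply/andP; split.
  by apply/sub_kermxP/IHk => s Ps ss; rewrite C0 // ltnW.
apply/sumsmx_subP=> i Pi; apply/sub_kermxP; rewrite -mulmxA.
apply: IHk => s Ps ss.
by have := C0 (i :: s); rewrite /= Pi Ps !mulmxA => ->.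
Qed.

(** A span that does not grow when one letter is added is stable under all the
    letters. *)
Lemma krylov_rank u k : u != 0 ->
    (forall j, (j < k)%N -> ~ forall i, P i -> stablemx (krylov u j) (B i)) ->
  (k < \rank (krylov u k))%N.
Proof.
move=> u_neq0; elim: k => [|k IHk] unst.
  by rewrite /= mxrank_gen lt0n mxrank_eq0.
have {}/IHk lt_k j (jk : (j < k)%N) := unst j (leqW jk).
rewrite ltnNge; apply/negP=> le_k; apply: (unst k) => // i Pi.
have lek : (krylov u k.+1 <= krylov u k)%MS.
  rewrite -(mxrank_leqif_sup (krylov_leS u k)) eqn_leq mxrankS ?krylov_leS //.
  exact: leq_trans le_k lt_k.
apply: submx_trans lek => /=; apply: submx_trans (addsmxSr _ _).
exact: (sumsmx_sup i).
Qed.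

Lemma stable_word_mx (W : 'M_n) s :
  (forall i, P i -> stablemx W (B i)) -> all P s -> stablemx W (word_mx s).
Proof.
move=> stW; elim: s => [|i s IHs] /=; first by move=> _; rewrite mulmx1.
by case/andP=> Pi Ps; apply: stablemxM; [apply: IHs | apply: stW].
Qed.

End Krylov.

End LinearAlgebra.

(** * Transformations acting on functions *)

Section FunctionsAsRows.

Variables (X : finType) (R : comNzRingType).
Implicit Types (f : X -> X) (v : X -> R).

Definition vec v : 'rV[R]_#|X| := \row_i v (enum_val i).

(** Acting on the right of rows, this matrix is the pull-back along f; acting on
    the left of columns, it is the push-forward of weights. *)
Definition comp_mx f : 'M[R]_#|X| :=
  \matrix_(i, j) (f (enum_val j) == enum_val i)%:R.

Definition total : 'cV[R]_#|X| := const_mx 1.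

Lemma vecK (u : 'rV[R]_#|X|) : vec (fun z => u 0 (enum_rank z)) = u.
Proof. by apply/rowP=> i; rewrite mxE enum_valK. Qed.

Lemma eq_comp_mx f1 f2 : f1 =1 f2 -> comp_mx f1 = comp_mx f2.
Proof. by move=> eq_f; apply/matrixP=> i j; rewrite !mxE eq_f. Qed.

Lemma vec_comp_mx v f : vec v *m comp_mx f = vec (v \o f).
Proof.
apply/rowP=> j; rewrite !mxE (bigD1 (enum_rank (f (enum_val j)))) //=.
rewrite !mxE enum_rankK eqxx mulr1 big1 ?addr0 // => i ne_i.
rewrite !mxE; case: eqP => [e|]; last by rewrite mulr0.
by rewrite e enum_valK eqxx in ne_i.
Qed.

Lemma comp_mxM f1 f2 : comp_mx f1 *m comp_mx f2 = comp_mx (f1 \o f2).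
Proof.
apply/row_matrixP=> i; rewrite !rowE mulmxA.
by rewrite -[delta_mx _ _]vecK !vec_comp_mx.
Qed.

Lemma comp_mx_id : comp_mx id = 1%:M.
Proof.
by apply/matrixP=> i j; rewrite !mxE (inj_eq enum_val_inj) eq_sym.
Qed.

Lemma vec_total v : vec v *m total = (\sum_z v z)%:M.
Proof.
apply/matrixP=> i j; rewrite !mxE !ord1 eqxx mulr1n.
rewrite (reindex (@enum_val _ X)) /=; last first.
  by apply: onW_bij; apply: enum_val_bij.
by apply: eq_bigr => k _; rewrite !mxE mulr1.
Qed.

End FunctionsAsRows.

Arguments total {X R}.
Arguments comp_mx {X} R f.

Lemma map_comp_mx (X : finType) (aF rF : fieldType) (phi : {rmorphism aF -> rF})
  (f : X -> X) : map_mx phi (comp_mx aF f) = comp_mx rF f.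
Proof. by apply/matrixP=> i j; rewrite !mxE rmorph_nat. Qed.

Section Words.

Variable X : finType.
Implicit Types (Sigma : {set {ffun X -> X}}) (w : seq {ffun X -> X}) (z : X).

Lemma word_act_cat z w1 w2 :
  word_act z (w1 ++ w2) = word_act (word_act z w1) w2.
Proof. exact: foldl_cat. Qed.

Lemma word_over_cat Sigma w1 w2 :
  word_over Sigma (w1 ++ w2) = word_over Sigma w1 && word_over Sigma w2.
Proof. exact: all_cat. Qed.

Lemma word_mx_comp_mx (R : fieldType) w :
  word_mx (fun a : {ffun X -> X} => comp_mx R a) w
    = comp_mx R (fun z => word_act z w).
Proof.
elim: w => [|a w IHw] /=; first by rewrite -comp_mx_id; apply: eq_comp_mx.
by rewrite IHw comp_mxM; apply: eq_comp_mx.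
Qed.

(** Pull-backs extend a word on the left and push-forwards on the right, hence
    the reversal. *)
Lemma word_mx_trmx_comp_mx (R : fieldType) w :
  word_mx (fun a : {ffun X -> X} => (comp_mx R a)^T) w
    = (comp_mx R (fun z => word_act z (rev w)))^T.
Proof.
elim: w => [|a w IHw] /=.
  by rewrite -[LHS]trmx1 -comp_mx_id; congr trmx; apply: eq_comp_mx.
rewrite IHw -trmx_mul comp_mxM; congr trmx; apply: eq_comp_mx => z.
by rewrite /= rev_cons -cats1 word_act_cat.
Qed.

End Words.

(** * Sets with no short expanding word *)

Section Extension.

Variables (gT : finGroupType) (Delta : {set gT}).
Variables (Sigma : {set {ffun gT -> gT}}) (D : nat).
Hypothesis sub_Sigma : cayley_graph Delta \subset Sigma.
Hypothesis sync : synchronizing Sigma.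
Hypothesis diam : forall g : gT, exists s : seq gT,
  [/\ all (mem Delta) s, (size s <= D)%N & g = (\prod_(d <- s) d)%g].
Hypothesis D_gt0 : (0 < D)%N.

Lemma translation_word g : exists w,
  [/\ word_over Sigma w, (size w <= D)%N & forall z, word_act z w = (z * g)%g].
Proof.
have [s [sD lesD ->]] := diam g; exists (map (@right_translation gT) s).
split; last 1 first.
- move=> z; elim: s {sD lesD} z => [|d s IHs] z /=.
    by rewrite big_nil mulg1.
  by rewrite big_cons IHs ffunE mulgA.
- apply/allP=> a /mapP[d ds ->]; apply: (subsetP sub_Sigma).
  by apply: imset_f; apply: (allP sD).
by rewrite size_map.
Qed.

(** A synchronizing word followed by a translation sends all of G to any
    prescribed g, and then the sum is n times f g. *)
Lemma all_words_weight0 (f : gT -> rat) :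
    (forall w, word_over Sigma w -> \sum_z f (word_act z w) = 0) ->
  forall g, f g = 0.
Proof.
move=> f0 g; have [w /andP[wS /cards1P[x wx]]] := sync.
have actw z : word_act z w = x by apply/set1P; rewrite -wx imset_f.
have [w' [w'S _ actw']] := translation_word (x^-1 * g)%g.
have := f0 (w ++ w'); rewrite word_over_cat wS w'S => /(_ isT).
under eq_bigr => z _ do rewrite word_act_cat actw actw' mulKVg.
rewrite sumr_const => /eqP; rewrite mulrn_eq0 => /orP[|/eqP //].
by rewrite cardT -cardE (cardD1 1%g).
Qed.

Section NonExpanding.

Variable f : gT -> rat.
Hypothesis f_neq0 : exists g, f g != 0.
Hypothesis sum_f : \sum_z f z = 0.
Hypothesis no_pos : forall w, word_over Sigma w -> (size w <= #|gT|)%N ->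
  \sum_z f (word_act z w) <= 0.

(** The sum over g of the left-hand sides is a multiple of the sum of f pulled
    back along w2, hence zero; none of its terms is positive, because each g is
    spelt by at most D letters. *)
Lemma averaging w1 w2 g :
    word_over Sigma w1 -> word_over Sigma w2 ->
    (size w1 + size w2 + D <= #|gT|)%N ->
    \sum_z f (word_act z w2) = 0 ->
  \sum_z f (word_act (word_act z w1 * g)%g w2) = 0.
Proof.
move=> w1S w2S le_n sum2.
have avg : \sum_h \sum_z f (word_act (word_act z w1 * h)%g w2) = 0.
  rewrite exchange_big big1 // => z _.
  by rewrite -[RHS]sum2 [RHS](reindex_inj (mulgI (word_act z w1))).
apply/eqP; rewrite -oppr_eq0; apply/eqP.
pose F h := - \sum_z f (word_act (word_act z w1 * h)%g w2).
apply: (@psumr_eq0P _ _ predT F) => //.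
  move=> h _; rewrite oppr_ge0; have [w [wS wD wact]] := translation_word h.
  have := @no_pos (w1 ++ w ++ w2).
  rewrite !word_over_cat w1S wS w2S => /(_ isT).
  under eq_bigr => z _ do rewrite !word_act_cat wact.
  apply; rewrite !size_cat; apply: leq_trans le_n.
  by rewrite addnA addnAC leq_add2l.
by rewrite sumrN avg oppr0.
Qed.

Lemma short_word_weight0 w :
  word_over Sigma w -> (size w + D <= #|gT|)%N -> \sum_z f (word_act z w) = 0.
Proof.
move=> wS le_n; have := @averaging w [::] 1%g wS isT.
rewrite addn0 => /(_ le_n sum_f) avg; rewrite -[RHS]avg.
by apply: eq_bigr => z _; rewrite /= mulg1.
Qed.

Lemma split_word_weight0 w1 w2 g :
    word_over Sigma w1 -> word_over Sigma w2 ->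
    (size w1 + size w2 + D <= #|gT|)%N ->
  \sum_z f (word_act (word_act z w1 * g)%g w2) = 0.
Proof.
move=> w1S w2S le_n; apply: averaging => //; apply: short_word_weight0 => //.
by apply: leq_trans le_n; rewrite -addnA leq_addl.
Qed.

Local Notation n := #|gT|.
Local Notation rho g := (comp_mx rat (fun z : gT => z * g)%g).

Local Notation pull a := (comp_mx rat (fun_of_fin a)).

(** Spanned by the pull-backs of f along words of length at most j. *)
Let Fs j : 'M[rat]_n := krylov (fun a => pull a) (mem Sigma) (vec f) j.

(** Spanned by the push-forwards of the uniform weight along words of length at
    most k. *)
Let Us k : 'M[rat]_n := krylov (fun a => (pull a)^T) (mem Sigma) total^T k.

(** The G-module generated by [Fs j]. *)
Let Ws j : 'M[rat]_n := (\sum_(g : gT) Fs j *m rho g)%MS.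

Lemma vec_f_neq0 : vec f != 0.
Proof.
have [g fg] := f_neq0; apply: contraNneq fg => /rowP/(_ (enum_rank g)).
by rewrite !mxE enum_rankK => ->.
Qed.

Lemma Fs_sub_Ws j : (Fs j <= Ws j)%MS.
Proof.
apply: (sumsmx_sup 1%g) => //.
rewrite -[X in (X <= _)%MS]mulmx1 -comp_mx_id.
by rewrite (@eq_comp_mx _ _ id (fun z => z * 1)%g) // => z; rewrite mulg1.
Qed.

Lemma Ws_leS j : (Ws j <= Ws j.+1)%MS.
Proof.
apply/sumsmx_subP=> g _; apply: (sumsmx_sup g) => //.
by rewrite submxMr // krylov_leS.
Qed.

Lemma Ws_rho j g : stablemx (Ws j) (rho g).
Proof.
rewrite sumsmxMr; apply/sumsmx_subP=> h _; rewrite -mulmxA comp_mxM.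
apply: (sumsmx_sup (g * h)%g) => //.
rewrite (@eq_comp_mx _ _ _ (fun z => z * (g * h))%g) // => z.
by rewrite /= mulgA.
Qed.

Lemma Ws_Us_ortho j k : (j + k + D <= n)%N -> Ws j *m (Us k)^T = 0.
Proof.
move=> le_n; apply/sub_kermxP/sumsmx_subP=> g _; apply/sub_kermxP.
rewrite -mulmxA; apply: krylov_mul0 => w2 w2S w2j.
rewrite word_mx_comp_mx vec_comp_mx mulmxA vec_comp_mx.
apply: trmx_inj; rewrite trmx_mul trmxK trmx0.
apply: krylov_mul0 => w1 w1S w1k; rewrite word_mx_trmx_comp_mx -!trmx_mul.
rewrite mulmxA vec_comp_mx vec_total /= split_word_weight0 //.
- by rewrite raddf0 trmx0.
- by rewrite /word_over all_rev.
rewrite size_rev; apply: leq_trans le_n.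
by rewrite leq_add2r addnC leq_add.
Qed.

(** A stable span would contain the push-forwards along all words, and a
    functional vanishing on these is zero by [all_words_weight0]; so a span
    that stops growing is the whole space. *)
Lemma rank_Us k : (k < n)%N -> (k < \rank (Us k))%N.
Proof.
have [/existsP[j /forall_inP st] | unstab] :=
    boolP [exists j : 'I_k, [forall a in Sigma, stablemx (Us j) (pull a)^T]].
  have free : row_free (Us j)^T.
    apply: inj_row_free => v vU0.
    suff v0 : forall g, v 0 (enum_rank g) = 0.
      by apply/rowP=> i; rewrite mxE -[i]enum_valK v0.
    apply: all_words_weight0 => w wS.
    have sub : (total^T *m (comp_mx rat (fun z => word_act z w))^T <= Us j)%MS.
      have := stable_word_mx (s := rev w) st.
      rewrite all_rev => /(_ wS); rewrite word_mx_trmx_comp_mx revK.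
      by apply: submx_trans; rewrite submxMr // krylov_base.
    have : v *m (total^T *m (comp_mx rat (fun z => word_act z w))^T)^T = 0.
      by case/submxP: sub => C ->; rewrite trmx_mul mulmxA vU0 mul0mx.
    rewrite -trmx_mul trmxK mulmxA -[v]vecK vec_comp_mx vec_total.
    move=> /matrixP/(_ 0 0); rewrite mxE eqxx mulr1n mxE /= => v0.
    rewrite -[RHS]v0.
    by apply: eq_bigr => z _; rewrite vecK.
  move=> lt_n; apply: leq_trans lt_n _.
  move: free; rewrite -row_leq_rank mxrank_tr => full; apply: leq_trans full _.
  by rewrite mxrankS // krylov_le // ltnW.
move=> lt_n; apply: krylov_rank => [|j jk st].
  apply/eqP=> /matrixP/(_ 0 (enum_rank 1%g)); rewrite !mxE => /eqP.
  by rewrite oner_eq0.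
by case/negP: unstab; apply/existsP; exists (Ordinal jk); apply/forall_inP.
Qed.

Lemma Ws_total0 j : (j + D <= n)%N -> Ws j *m total = 0.
Proof.
move=> le_n; have := @Ws_Us_ortho j 0; rewrite addn0 => /(_ le_n) ortho.
have /submxP[C totE] : (total^T <= Us 0)%MS by apply: krylov_base.
by rewrite -[total]trmxK totE trmx_mul mulmxA ortho mul0mx.
Qed.

(** A stable span would contain the pull-backs of f along all words, all of sum
    zero, which [all_words_weight0] excludes. *)
Lemma rank_Fs j : (j + D <= n)%N -> (j < \rank (Fs j))%N.
Proof.
move=> le_n; apply: krylov_rank => [|i ij st]; first exact: vec_f_neq0.
have [g /eqP[]] := f_neq0; apply: all_words_weight0 => w wS.
have sub : (vec f *m comp_mx rat (fun z => word_act z w) <= Ws i)%MS.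
  apply: submx_trans (Fs_sub_Ws i).
  have := stable_word_mx st wS; rewrite word_mx_comp_mx.
  by apply: submx_trans; rewrite submxMr // krylov_base.
have /submxP[C eqC] := sub.
have := vec_total (f \o (fun z => word_act z w)); rewrite -vec_comp_mx eqC.
rewrite -mulmxA Ws_total0.
2: by apply: leq_trans le_n; rewrite leq_add2r ltnW.
by move/matrixP/(_ 0 0); rewrite mulmx0 !mxE eqxx mulr1n.
Qed.

Lemma rank_Ws_lt j : (j + D <= n)%N -> (\rank (Ws j) < j + D)%N.
Proof.
move=> le_n; pose k := (n - (j + D))%N.
have ltk : (k < n)%N by rewrite /k; move: le_n D_gt0; lia.
have := mulmx0_rank_max (@Ws_Us_ortho j k _).
rewrite mxrank_tr addnAC subnKC // leqnn => /(_ isT) le_sum.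
have := rank_Us ltk; rewrite -(ltn_add2l (\rank (Ws j))).
move=> /leq_trans/(_ le_sum).
move: (\rank (Ws j)) => r; rewrite /k; lia.
Qed.

(** With E the kernel of q(T), at the first j for which [Ws j] meets E the
    dimension exceeds that of the preceding module, zero if j = 0, by at least
    deg q >= D, against [rank_Fs] and [rank_Ws_lt]; and [Ws (n - D)] does meet E, by dimensions. *)
Lemma nonexpanding_absurd (T : 'M[rat]_n) (q : {poly rat}) :
    (forall W : 'M_n, (forall g, stablemx W (rho g)) -> stablemx W T) ->
    irreducible_poly q -> (D < size q)%N -> (D <= n)%N -> kermxpoly T q != 0 ->
  False.
Proof.
move=> stT irr_q lt_q le_n E_neq0; set E := kermxpoly T q in E_neq0.
have leD : (D <= (size q).-1)%N by move: lt_q; lia.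
have WsT j : stablemx (Ws j) T by apply: stT => g; apply: Ws_rho.
have rankE : (D <= \rank E)%N by apply: leq_trans leD (rank_kermxpoly _ _).
have cap0 j : (j + D <= n)%N -> (Ws j :&: E)%MS = 0.
  elim: j => [|j IHj] lejD; apply/eqP/negPn/negP => cap_neq0.
    have := rank_Ws_lt lejD; rewrite ltnNge => /negP[].
    apply: leq_trans leD (leq_trans _ (mxrankS (capmxSl (Ws 0) E))).
    exact: rank_kermxpoly_irreducible.
  have lejD' : (j + D <= n)%N by apply: leq_trans lejD; rewrite addSn leqW.
  have big : (D <= \rank (Ws j.+1 :&: E))%N.
    by apply: leq_trans leD _; apply: rank_kermxpoly_irreducible.
  have dir : (Ws j :&: (Ws j.+1 :&: E) = 0)%MS.
    apply/eqP; rewrite -submx0 -(IHj lejD') sub_capmx capmxSl /=.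
    exact: submx_trans (capmxSr _ _) (capmxSr _ _).
  have := rank_Ws_lt lejD; rewrite ltnNge => /negP[].
  apply: (@leq_trans (\rank (Ws j + (Ws j.+1 :&: E))%MS)).
    rewrite mxrank_disjoint_sum // leq_add //.
    exact: leq_trans (rank_Fs lejD') (mxrankS (Fs_sub_Ws j)).
  by rewrite mxrankS // addsmx_sub Ws_leS capmxSl.
have ltF := @rank_Fs (n - D); have := mxrank_disjoint_sum (cap0 (n - D)%N _).
rewrite subnK // leqnn => /(_ isT) rk.
have := rank_leq_col (Ws (n - D) + E)%MS; rewrite rk leqNgt => /negP[].
rewrite -{1}(subnK le_n) -addSn leq_add //.
apply: leq_trans (mxrankS (Fs_sub_Ws _)); apply: ltF.
by rewrite subnK.
Qed.

End NonExpanding.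
End Extension.

(** * The eigenvalue criterion *)

Section Criterion.

Variables (gT : finGroupType) (Delta : {set gT}) (D : nat).
Hypothesis diam : forall g : gT, exists s : seq gT,
  [/\ all (mem Delta) s, (size s <= D)%N & g = (\prod_(d <- s) d)%g].
Hypothesis D_gt0 : (0 < D)%N.

Local Notation n := #|gT|.
Local Notation rho g := (comp_mx rat (fun z : gT => z * g)%g).

Variables (T : 'M[rat]_n) (q : {poly rat}).
Hypothesis stable_T :
  forall W : 'M_n, (forall g, stablemx W (rho g)) -> stablemx W T.
Hypothesis irr_q : irreducible_poly q.
Hypothesis lt_D_q : (D < size q)%N.
Hypothesis ker_neq0 : kermxpoly T q != 0.

Lemma diam_le_card : (D <= n)%N.
Proof.
have le_n := leq_trans (rank_kermxpoly irr_q ker_neq0) (rank_leq_col _).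
by apply: leq_trans le_n; move: lt_D_q; case: (size q).
Qed.

Section Sigma.

Variable Sigma : {set {ffun gT -> gT}}.
Hypothesis sub_Sigma : cayley_graph Delta \subset Sigma.
Hypothesis sync : synchronizing Sigma.

Lemma positive_word (f : gT -> rat) :
    (exists g, f g != 0) -> \sum_z f z = 0 ->
  exists w, [/\ word_over Sigma w, (size w <= n)%N
              & 0 < \sum_z f (word_act z w)].
Proof.
move=> f_neq0 sum_f.
(* The words of bounded length form a finite type: the search is decidable. *)
have [|none] := boolP [exists k : 'I_n.+1, exists w : k.-tuple {ffun gT -> gT},
    word_over Sigma w && (0 < \sum_z f (word_act z w))].
  case/existsP=> k /existsP[w /andP[wS pos]]; exists w; split=> //.
  by rewrite size_tuple -ltnS.
case: (nonexpanding_absurd sub_Sigma sync diam D_gt0 f_neq0 sum_f _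
         stable_T irr_q lt_D_q diam_le_card ker_neq0).
move=> w wS; rewrite -ltnS => le_n; rewrite leNgt; apply/negP=> pos.
case/negP: none; apply/existsP; exists (Ordinal le_n).
by apply/existsP; exists (in_tuple w); rewrite wS.
Qed.

Lemma expanding_word (S : {set gT}) : (0 < #|S| < n)%N ->
  exists w, [/\ word_over Sigma w, (size w <= n)%N
              & (#|S| < #|[set z | word_act z w \in S]|)%N].
Proof.
case/andP=> S_gt0 S_ltn.
pose f z : rat := (z \in S)%:R * n%:R - #|S|%:R.
have sum_f (h : gT -> gT) :
    \sum_z f (h z) = n%:R * (#|[set z | h z \in S]|%:R - #|S|%:R).
  rewrite /f big_split /= sumrN sumr_const -mulr_suml -natr_sum.
  rewrite -big_mkcond /= sum1_card.
  rewrite mulrBr [X in _ = X - _]mulrC; congr (_%:R * _ - _).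
    by apply: eq_card => z; rewrite !inE.
  by rewrite mulr_natl.
have [|| w [wS w_le pos]] := @positive_word f.
- have [z zS] := card_gt0P S_gt0; exists z.
  by rewrite /f zS mul1r subr_eq0 eqr_nat neq_ltn S_ltn orbT.
- rewrite (sum_f id); rewrite (_ : [set z | id z \in S] = S) ?subrr ?mulr0 //.
  by apply/setP=> z; rewrite inE.
exists w; split=> //; move: pos; rewrite sum_f pmulr_rgt0 ?subr_gt0 ?ltr_nat //.
by rewrite ltr0n (leq_ltn_trans _ S_ltn).
Qed.

Lemma expanding_word_iter k (S : {set gT}) : (0 < #|S|)%N ->
  exists w, [/\ word_over Sigma w, (size w <= k * n)%N
              & (minn n (#|S| + k) <= #|[set z | word_act z w \in S]|)%N].
Proof.
move=> S_gt0; elim: k => [|k [w [wS le_w grow]]].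
  exists [::]; split=> //; rewrite addn0 (leq_trans (geq_minr _ _)) //.
  by rewrite (_ : [set _ | _] = S) //; apply/setP=> z; rewrite inE.
set S' := [set z | _] in grow.
have [lt_n | ge_n] := ltnP #|S'| n; last first.
  exists w; split=> //; last exact: leq_trans (geq_minl _ _) ge_n.
  by rewrite mulSn (leq_trans le_w) // leq_addl.
have [|w' [w'S le_w' grow']] := @expanding_word S'.
  rewrite lt_n (leq_trans _ grow) // leq_min addn_gt0 S_gt0.
  by rewrite (leq_ltn_trans _ lt_n).
exists (w' ++ w); rewrite word_over_cat w'S wS size_cat mulSn leq_add //.
split=> //; rewrite (_ : [set z | _] = [set z | word_act z w' \in S']).
  by move: grow grow' lt_n; lia.
by apply/setP=> z; rewrite !inE word_act_cat.
Qed.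

Lemma noninjective_letter : (1 < n)%N ->
  exists2 a : {ffun gT -> gT}, a \in Sigma
    & exists x : gT, (1 < #|[set z | a z == x]|)%N.
Proof.
move=> n_gt1; have [w /andP[wS /eqP w1]] := sync.
have [/exists_inP [a aS ninj] | inj] :=
    boolP [exists a : {ffun gT -> gT} in Sigma, ~~ injectiveb a].
  have /injectivePn[x [y ne_xy axy]] := ninj.
  exists a => //; exists (a x); apply/card_gt1P; exists x, y.
  by rewrite !inE eqxx axy eqxx.
have inj_w : injective (fun z => word_act z w).
  elim: w wS {w1} => [_ x y //|a w IHw /= /andP[aS wS] x y /(IHw wS)].
  apply/injectiveP; apply: contraNT inj => ninj.
  by apply/exists_inP; exists a.
have := card_imset predT inj_w; rewrite w1 -[#|predT|]/n => e1.
by rewrite -e1 in n_gt1.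
Qed.

End Sigma.

(** One letter pulls some point back to at least two points, and n - 2
    expansions of length at most n complete the set. *)
Lemma cerny_of_stable_operator : cerny_cayley_graph Delta.
Proof.
move=> Sigma sub_Sigma sync.
have [n_gt1 | n_le1] := ltnP 1%N n; last first.
  (* The trivial group is synchronized by the empty word. *)
  exists [::]; split=> //; rewrite /synchronizing_word /=.
  rewrite eqn_leq (leq_trans (max_card _) n_le1); apply/card_gt0P; exists 1%g.
  exact: (@imset_f _ _ (fun z : gT => z) _ 1%g).
have [a aS [x ax]] := noninjective_letter sync n_gt1.
set S := [set z | _] in ax.
have [|w [wS le_w grow]] := @expanding_word_iter _ sub_Sigma sync (n - 2) S.
  exact: ltnW.
exists (w ++ [:: a]); split; last first.
  rewrite size_cat /= addn1.
  move: le_w; case: #|gT| n_gt1 => [|[|m]] // _; rewrite !subSS subn0 => le_w.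
  apply: (@leq_trans (m * m.+2).+1); first by rewrite ltnS.
  by rewrite -mulnn; nia.
rewrite /synchronizing_word word_over_cat wS /= aS /=.
apply/cards1P; exists x; apply/eqP; rewrite eqEcard cards1.
have -> : (0 < #|[set word_act z (w ++ [:: a]) | z : gT]|)%N.
  by apply/card_gt0P; exists (word_act 1%g (w ++ [:: a])); apply: imset_f.
rewrite andbT; apply/subsetP=> y /imsetP[z _ ->]; rewrite inE word_act_cat /=.
have : z \in [set z | word_act z w \in S].
  suff -> : [set z | word_act z w \in S] = setT by [].
  apply/eqP; rewrite eqEcard subsetT cardsT; apply: leq_trans grow.
  by rewrite leq_min leqnn /= -{1}(subnKC n_gt1) leq_add2r.
by rewrite !inE.
Qed.

End Criterion.

Lemma minCpoly_rat (mu : algC) : exists q : {poly rat},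
  [/\ irreducible_poly q, size q = size (minCpoly mu)
    & root (map_poly ratr q) mu].
Proof.
have [q [eq_q mon_q] div_q] := minCpolyP mu; exists q.
have size_q : size q = size (minCpoly mu) by rewrite eq_q size_map_poly.
split=> //; last by rewrite -eq_q root_minCpoly.
split=> [|d d_neq1 /dvdpP[e qE]]; first by rewrite size_q size_minCpoly.
have : root (map_poly ratr q) mu by rewrite -eq_q root_minCpoly.
have q_neq0 := monic_neq0 mon_q.
have [e_neq0 d_neq0] : e != 0 /\ d != 0.
  by apply/andP; rewrite -negb_or -mulf_eq0 -qE.
rewrite {1}qE rmorphM rootM !div_q => /orP[/dvdp_leq | q_d].
  rewrite qE size_mul // => /(_ e_neq0).
  have := d_neq0; rewrite -size_poly_gt0; move: d_neq1; lia.
by rewrite /eqp q_d qE dvdp_mull.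
Qed.

Lemma eigenvector_sub_kermxpoly
    (F : fieldType) n (A : 'M[F]_n) (v : 'rV_n) a p :
  v *m A = a *: v -> root p a -> (v <= kermxpoly A p)%MS.
Proof.
case: n A v => [|n] A v; first by rewrite [v]thinmx0 sub0mx.
move=> vA /factor_theorem[r ->]; apply/sub_kermxP.
rewrite mulrC rmorphM rmorphB /= horner_mx_X horner_mx_C mulmxA.
by rewrite mulmxBr vA mul_mx_scalar subrr mul0mx.
Qed.

(** The element sum of the h i of the group ring is given through its action on
    functions.  Its eigenvector v has algebraic values only; base change brings
    the kernel of the minimal polynomial back to the rationals. *)
Theorem cerny_of_eigenvalue (gT : finGroupType) (Delta : {set gT}) (D : nat)
    (I : finType) (P : pred I) (h : I -> gT) (mu : algC) (v : gT -> algC) :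
    (forall g : gT, exists s : seq gT,
      [/\ all (mem Delta) s, (size s <= D)%N & g = (\prod_(d <- s) d)%g]) ->
    (0 < D < size (minCpoly mu))%N ->
    (exists g, v g != 0) ->
    (forall g, \sum_(i | P i) v (g * h i)%g = mu * v g) ->
  cerny_cayley_graph Delta.
Proof.
move=> diam /andP[D_gt0 ltD] [g0 vg0] eig_v.
have [q [irr_q size_q root_q]] := minCpoly_rat mu.
pose T : 'M[rat]_#|gT| := \sum_(i | P i) comp_mx rat (fun z : gT => z * h i)%g.
apply: (@cerny_of_stable_operator _ _ D diam D_gt0 T q) => //.
- move=> W stW; rewrite /T; elim/big_rec: _ => [|i A _ stA].
    exact: stablemx0.
  exact: stablemxD.
- by rewrite size_q.
have := eigenpoly_map (@ratr algC) T q; rewrite /eigenpoly => <-.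
apply/rowV0Pn; exists (vec v); last first.
  apply: contraNneq vg0 => /rowP/(_ (enum_rank g0)).
  by rewrite !mxE enum_rankK => ->.
apply: (@eigenvector_sub_kermxpoly _ _ _ _ mu) => //.
rewrite /T map_mx_sum mulmx_sumr.
rewrite (eq_bigr (fun i => vec (fun g => v (g * h i)%g))) => [|i _].
  apply/rowP=> k; rewrite summxE !mxE -eig_v.
  by apply: eq_bigr => i _; rewrite mxE.
by rewrite map_comp_mx vec_comp_mx.
Qed.

(** * Short words in PSL(2, p) *)

Section SpecialLinear.

Variable p : nat.
Local Notation K := 'F_p.

Lemma mx22E (M : 'M[K]_2) : M = mx22 (M 0 0) (M 0 1) (M 1 0) (M 1 1).
Proof.
apply/matrixP=> i j; rewrite !mxE.
case: i => [[|[|//]] i] /=; case: j => [[|[|//]] j] /=;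
  by congr (M _ _); apply: val_inj.
Qed.

Lemma mx22M (a b c d a' b' c' d' : K) :
  mx22 a b c d * mx22 a' b' c' d'
    = mx22 (a * a' + b * c') (a * b' + b * d')
           (c * a' + d * c') (c * b' + d * d').
Proof.
apply/matrixP=> i j; rewrite -mulmxE !mxE !big_ord_recl big_ord0 addr0 !mxE /=.
by case: i => [[|[|//]] i] /=; case: j => [[|[|//]] j] /=.
Qed.

Lemma mx22_eq (a b c d a' b' c' d' : K) :
  mx22 a b c d = mx22 a' b' c' d' -> [/\ a = a', b = b', c = c' & d = d'].
Proof.
move=> /matrixP eqM.
have := (eqM 0 0, eqM 0 1, eqM 1 0, eqM 1 1).
by rewrite !mxE /= => -[[[-> ->] ->] ->].
Qed.

Lemma SL2_det (u : {'GL_2(p)}) : u \in SL2 p ->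
  GLval u 0 0 * GLval u 1 1 - GLval u 0 1 * GLval u 1 0 = 1.
Proof. by rewrite inE {1}[GLval u]mx22E mx22_det => /eqP. Qed.

Lemma GLval_inj (u v : {'GL_2(p)}) : GLval u = GLval v -> u = v.
Proof. exact: val_inj. Qed.

Lemma GLval_SL2x_exp i : GLval (SL2x p ^+ i)%g = mx22 1 i%:R 0 1.
Proof.
elim: i => [|i IHi].
  by rewrite expg0 GL_1E [LHS]mx22E !mxE.
by rewrite expgSr GL_ME IHi /= mx22M; congr mx22; rewrite -?natr1; ring.
Qed.

Lemma GLval_SL2y_exp i : GLval (SL2y p ^+ i)%g = mx22 1 0 i%:R 1.
Proof.
elim: i => [|i IHi].
  by rewrite expg0 GL_1E [LHS]mx22E !mxE.
by rewrite expgSr GL_ME IHi /= mx22M; congr mx22; rewrite -?natr1; ring.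
Qed.

Lemma PSL2_cosetM : {in SL2 p &, {morph @PSL2_coset p : u v / (u * v)%g}}.
Proof.
have nSL := subsetP (normal_norm (pmI_normal p)).
move=> u v uS vS; rewrite /PSL2_coset morphM ?nSL // subgM //.
  exact: mem_quotient.
exact: mem_quotient.
Qed.

Lemma PSL2_cosetP (g : PSL2 p) : exists2 u, u \in SL2 p & g = PSL2_coset u.
Proof.
have /morphimP[u _ uS eq_g] : sgval g \in (SL2_group p / pmI_group p)%g.
  exact: subgP.
by exists u => //; rewrite /PSL2_coset -[LHS]sgvalK eq_g.
Qed.

Lemma PSL2_coset_eq u v : u \in SL2 p -> v \in SL2 p ->
  PSL2_coset u = PSL2_coset v -> GLval u = GLval v \/ GLval u = - GLval v.
Proof.
have nSL := subsetP (normal_norm (pmI_normal p)).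
move=> uS vS /(congr1 sgval); rewrite !subgK ?mem_quotient // => /eqP.
move=> /eqP/(rcoset_kercosetP (nSL _ uS) (nSL _ vS)).
rewrite mem_rcoset inE GL_ME GL_VE => /orP[] /eqP uv; [left | right].
  by rewrite -[LHS](mulrVK (GL_unit v)) uv mul1r.
by rewrite -[LHS](mulrVK (GL_unit v)) uv mulN1r.
Qed.

Local Notation letters := [set SL2x p; SL2y p].

Lemma val_le_pred (hp : prime p) (a : K) : (a <= p.-1)%N.
Proof.
rewrite -ltnS prednK ?prime_gt0 //.
by rewrite -[X in (_ < X)%N](Fp_cast hp) ltn_ord.
Qed.

(** A matrix with a nonzero off-diagonal entry is a product of three powers
    x^i y^c x^k or y^i x^b y^k.  The diagonal matrix of a and 1/a is
    x^(a-1) y x^((1-a)/a) y^(-a); the exponent a - 1 is at most p - 2, which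
    makes room for the isolated letter y. *)
Lemma SL2_words (hp : prime p) (u : {'GL_2(p)}) : u \in SL2 p ->
  exists s, [/\ all (mem letters) s, (size s <= 3 * p.-1)%N
              & u = (\prod_(a <- s) a)%g].
Proof.
move=> uS; have det1 := SL2_det uS.
set a := GLval u 0 0 in det1; set b := GLval u 0 1 in det1.
set c := GLval u 1 0 in det1; set d := GLval u 1 1 in det1.
have uE : GLval u = mx22 a b c d by apply: mx22E.
move: a b c d uE det1 => a b c d uE det1.
have prodE (x : {'GL_2(p)}) i : (\prod_(y <- nseq i x) y = x ^+ i)%g.
  by rewrite big_nseq -Monoid.iteropE.
have allE (x : {'GL_2(p)}) i : x \in letters -> all (mem letters) (nseq i x).
  by move=> xL; rewrite all_nseq [mem _ _]xL orbT.
have xL : SL2x p \in letters by rewrite !inE eqxx.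
have yL : SL2y p \in letters by rewrite !inE eqxx orbT.
have le := val_le_pred hp.
have [c0 | c_neq0] := eqVneq c 0; last first.
  pose i : K := (a - 1) / c; pose k : K := (d - 1) / c.
  exists (nseq i (SL2x p) ++ nseq c (SL2y p) ++ nseq k (SL2x p)); split.
  - by rewrite !all_cat !allE.
  - by rewrite !size_cat !size_nseq; move: (le i) (le c) (le k); lia.
  apply: GLval_inj; rewrite !big_cat !prodE !GL_ME.
  rewrite GLval_SL2y_exp !GLval_SL2x_exp uE.
  have -> : b = (a * d - 1) / c by rewrite -det1; field.
  by rewrite !natr_Zp !mx22M /i /k; congr mx22; field.
have [b0 | b_neq0] := eqVneq b 0; last first.
  pose i : K := (d - 1) / b; pose k : K := (a - 1) / b.
  exists (nseq i (SL2y p) ++ nseq b (SL2x p) ++ nseq k (SL2y p)); split.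
  - by rewrite !all_cat !allE.
  - by rewrite !size_cat !size_nseq; move: (le i) (le b) (le k); lia.
  apply: GLval_inj; rewrite !big_cat !prodE !GL_ME.
  rewrite GLval_SL2x_exp !GLval_SL2y_exp uE.
  have -> : c = (a * d - 1) / b by rewrite -det1; field.
  by rewrite !natr_Zp !mx22M /i /k; congr mx22; field.
move: det1; rewrite b0 c0 mul0r subr0 => ad1.
have a_neq0 : a != 0.
  by apply: contra_eqN ad1 => /eqP->; rewrite mul0r eq_sym oner_eq0.
have dE : d = a^-1 by rewrite -[d](mulKf a_neq0) ad1 mulr1.
have [a1 | a_neq1] := eqVneq a 1.
  exists [::]; split=> //; apply: GLval_inj.
  rewrite big_nil GL_1E uE b0 c0 dE a1 invr1.
  by rewrite [RHS]mx22E !mxE.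
pose s : K := a - 1; pose b' : K := - s / a.
have s_lt : (s < p.-1)%N.
  rewrite ltn_neqAle le andbT; apply: contra_neqN a_neq0 => /eqP s_eq.
  rewrite -[a](subrK 1) -/s -[s]natr_Zp s_eq natr1 prednK ?prime_gt0 //.
  by apply/eqP; rewrite -(Fp_nat_mod hp) modnn.
exists (nseq s (SL2x p) ++ nseq 1 (SL2y p)
  ++ nseq b' (SL2x p) ++ nseq (- a : K) (SL2y p)); split.
- by rewrite !all_cat !allE.
- rewrite !size_cat !size_nseq; move: (le b') (le (- a)) s_lt; lia.
apply: GLval_inj; rewrite !big_cat !prodE !GL_ME.
rewrite !GLval_SL2x_exp !GLval_SL2y_exp uE b0 c0 dE.
by rewrite !natr_Zp !mx22M /b' /s; congr mx22; field.
Qed.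

Local Notation Delta := [set PSL2_coset (SL2x p); PSL2_coset (SL2y p)].

Lemma PSL2_words (hp : prime p) (g : PSL2 p) :
  exists s, [/\ all (mem Delta) s, (size s <= 3 * p.-1)%N
              & g = (\prod_(d <- s) d)%g].
Proof.
have [u uS ->] := PSL2_cosetP g; have [s [sL le_s ->]] := SL2_words hp uS.
exists (map (@PSL2_coset p) s); split; last 1 first.
- rewrite big_map; have lettersS a : a \in letters -> a \in SL2 p.
    by rewrite !in_set2 => /orP[]/eqP->; [apply: SL2x_in | apply: SL2y_in].
  have [_ //] : (\prod_(a <- s) a)%g \in SL2 p /\
      PSL2_coset (\prod_(a <- s) a)%g = (\prod_(a <- s) PSL2_coset a)%g.
    elim: s sL {le_s} => [_ | a s IHs /andP[/lettersS aS /IHs[prodS prodE]]].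
      by rewrite !big_nil group1 /PSL2_coset !morph1.
    by rewrite !big_cons PSL2_cosetM // prodE groupM.
- apply/allP=> d /mapP[a /(allP sL) + ->].
  by rewrite !inE => /orP[]/eqP->; rewrite eqxx ?orbT.
by rewrite size_map.
Qed.

Lemma PSL2_generated (hp : prime p) : (<<Delta>> = [set: PSL2 p])%g.
Proof.
apply/eqP; rewrite eqEsubset subsetT; apply/subsetP=> g _.
have [s [/allP sD _ ->]] := PSL2_words hp g.
rewrite big_seq; apply: group_prod => d ds; apply: mem_gen; exact: sD.
Qed.

End SpecialLinear.

(** * An eigenvector in the principal series *)

Lemma primitive_root_neq0 (R : nzRingType) n (z : R) :
  n.-primitive_root z -> z != 0.
Proof.
move=> prim_z.
by rewrite (prim_root_eq0 prim_z) -lt0n (prim_order_gt0 prim_z).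
Qed.

Lemma Fp_unit_order p (c : 'F_p) : prime p -> c != 0 -> c ^+ p.-1 = 1.
Proof.
move=> hp c_neq0; apply: (mulfI c_neq0).
rewrite mulr1 -exprS prednK ?prime_gt0 //.
by have := expf_card c; rewrite card_Fp.
Qed.

Lemma Fp_primitive_root p :
  prime p -> exists t : 'F_p, (p.-1).-primitive_root t.
Proof.
move=> hp; have p_gt1 := prime_gt1 hp.
have : has (p.-1).-primitive_root (enum (predC1 (0 : 'F_p))).
  apply: cyclic.has_prim_root; rewrite ?enum_uniq -?cardE ?cardC1 ?card_Fp //.
    by rewrite -ltnS prednK // ltnW.
  apply/allP=> c; rewrite mem_enum unity_rootE => c_neq0.
  by rewrite Fp_unit_order ?subrr.
by case/hasP=> t _ prim_t; exists t.
Qed.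

Section PrincipalSeries.

Variable p : nat.
Hypothesis hp : prime p.
Hypothesis p_gt3 : (3 < p)%N.
Local Notation K := 'F_p.
Local Notation N := p.-1./2.

Variables (t : K) (omega zeta : algC).
Hypothesis prim_t : (p.-1).-primitive_root t.
Hypothesis prim_omega : N.-primitive_root omega.
Hypothesis prim_zeta : p.-primitive_root zeta.

Lemma half_predK : (N * 2 = p.-1)%N.
Proof.
rewrite muln2 -[RHS]odd_double_half; have [p2 | ] := even_prime hp.
  by move: p_gt3; rewrite p2.
by rewrite -{1}(prednK (prime_gt0 hp)) /= => /negbTE ->.
Qed.

Definition dlog (c : K) : nat :=
  odflt 0%N (omap val [pick i : 'I_p.-1 | c == t ^+ i]).

Lemma dlogK c : c != 0 -> t ^+ dlog c = c.
Proof.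
move=> /(Fp_unit_order hp)/(prim_rootP prim_t)[i ci]; rewrite /dlog.
by case: pickP => [j /eqP -> // | /(_ i)]; rewrite ci eqxx.
Qed.

Definition chi (c : K) : algC := omega ^+ dlog c.

Lemma chi_exp i : chi (t ^+ i) = omega ^+ i.
Proof.
have ti_neq0 : t ^+ i != 0 by rewrite expf_neq0 // (primitive_root_neq0 prim_t).
apply/eqP; rewrite (eq_prim_root_expr prim_omega).
have eq_mod : dlog (t ^+ i) = i %[mod N * 2].
  by rewrite half_predK; apply/eqP; rewrite -(eq_prim_root_expr prim_t) dlogK.
apply/eqP; have N_dvd : (N %| N * 2)%N by apply: dvdn_mulr.
by rewrite -[LHS](modn_dvdm _ N_dvd) eq_mod modn_dvdm.
Qed.

Lemma chiM c d : c != 0 -> d != 0 -> chi (c * d) = chi c * chi d.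
Proof.
by move=> /dlogK cE /dlogK dE; rewrite -{1}cE -{1}dE -exprD chi_exp exprD.
Qed.

Lemma chi_t : chi t = omega.
Proof. by rewrite -[t]expr1 chi_exp. Qed.

Lemma chi_tV : chi t^-1 = omega^-1.
Proof.
have t_neq0 : t != 0 by apply: primitive_root_neq0 prim_t.
have o_neq0 : omega != 0 by apply: primitive_root_neq0 prim_omega.
apply: (mulfI o_neq0).
rewrite mulfV // -[in LHS]chi_t -chiM ?invr_eq0 // divff //.
by rewrite -(expr0 t) chi_exp.
Qed.

(** As the order of omega is (p - 1) / 2 and not p - 1, chi is trivial on -1, so
    that it lives on PSL(2, p). *)
Lemma chiN1 : chi (-1) = 1.
Proof.
have N1_neq0 : (-1 : K) != 0 by rewrite oppr_eq0 oner_eq0.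
have := dlogK N1_neq0; rewrite /chi; move: (dlog _) => i ti.
have : t ^+ (i * 2) == 1 by rewrite exprM ti sqrrN expr1n.
rewrite -(prim_order_dvd prim_t) -[X in (X %| _)%N]half_predK.
rewrite dvdn_pmul2r // => N_i.
by apply/eqP; rewrite -(prim_order_dvd prim_omega).
Qed.

Lemma chi_neq0 c : chi c != 0.
Proof. by rewrite expf_neq0 // (primitive_root_neq0 prim_omega). Qed.

(** The vector of the principal series of chi on which the translation by x is
    zeta, as a function of the bottom row (c, d) of a matrix. *)
Definition phi (c d : K) : algC :=
  if c == 0 then 0 else chi c * zeta ^+ (d / c : K).

Lemma phi_scale k c d : k != 0 -> phi (k * c) (k * d) = chi k * phi c d.
Proof.
move=> k_neq0; rewrite /phi mulf_eq0 (negPf k_neq0) orFb.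
have [c0 | c_neq0] := eqVneq c 0; first by rewrite mulr0.
by rewrite chiM // -mulrA -mulf_div divff // mul1r.
Qed.

Lemma zeta_expD (a b : K) : zeta ^+ (a + b)%R = zeta ^+ a * zeta ^+ b.
Proof.
rewrite -exprD; apply/eqP; rewrite (eq_prim_root_expr prim_zeta).
by rewrite -[X in _ == _ %[mod X]](Fp_cast hp) modn_mod.
Qed.

Lemma phi_shift c d : phi c (c + d) = zeta * phi c d.
Proof.
rewrite /phi; have [c0 | c_neq0] := eqVneq c 0; first by rewrite mulr0.
by rewrite mulrCA mulrDl divff // zeta_expD.
Qed.

Definition bottom_phi (u : {'GL_2(p)}) : algC :=
  phi (GLval u 1 0) (GLval u 1 1).

Definition psl_phi (g : PSL2 p) : algC :=
  bottom_phi (odflt 1%g [pick u in SL2 p | PSL2_coset u == g]).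

Lemma psl_phi_coset u : u \in SL2 p -> psl_phi (PSL2_coset u) = bottom_phi u.
Proof.
move=> uS; rewrite /psl_phi.
case: pickP => [w | /(_ u)]; last by rewrite uS eqxx.
case/andP=> wS /eqP eq_wu; rewrite /bottom_phi /=.
have [-> // | ->] := PSL2_coset_eq wS uS eq_wu.
rewrite !mxE -mulN1r -[X in phi _ X]mulN1r phi_scale ?chiN1 ?mul1r //.
by rewrite oppr_eq0 oner_eq0.
Qed.

Lemma SL2_exists a b c d : a * d - b * c = 1 ->
  exists u : {'GL_2(p)}, GLval u = mx22 a b c d.
Proof.
move=> det1; have u_unit : mx22 a b c d \is a GRing.unit.
  by rewrite -[_ \is a _]/(_ \in unitmx) unitmxE mx22_det det1 unitr1.
by exists (Sub (mx22 a b c d) u_unit).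
Qed.

Definition SL2_of (a b c d : K) : {'GL_2(p)} :=
  odflt 1%g [pick u : {'GL_2(p)} | GLval u == mx22 a b c d].

Lemma GLval_SL2_of a b c d :
  a * d - b * c = 1 -> GLval (SL2_of a b c d) = mx22 a b c d.
Proof.
move=> /SL2_exists[u uE]; rewrite /SL2_of.
by case: pickP => [w /eqP // | /(_ u)]; rewrite uE eqxx.
Qed.

Definition trace_class (u : {'GL_2(p)}) : bool :=
  (u \in SL2 p) && (\tr (GLval u) == t + t^-1).

Lemma mx22_tr (a b c d : K) : \tr (mx22 a b c d) = a + d.
Proof. by rewrite /mxtrace !big_ord_recl big_ord0 addr0 !mxE. Qed.

Lemma trace_classE u : trace_class u =
  (GLval u 0 0 * GLval u 1 1 - GLval u 0 1 * GLval u 1 0 == 1)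
    && (GLval u 0 0 + GLval u 1 1 == t + t^-1).
Proof.
by rewrite /trace_class inE {1 2}[GLval u]mx22E mx22_det mx22_tr.
Qed.

Lemma trace_classJ u w : w \in SL2 p -> trace_class (u ^ w)%g = trace_class u.
Proof.
move=> wS; rewrite /trace_class memJ_norm ?(subsetP (normG _)) //.
congr (_ && (_ == _)).
rewrite /conjg !GL_ME GL_VE -!mulmxE mxtrace_mulC -mulmxA !mulmxE.
by rewrite mulrV ?mulr1 ?GL_unit.
Qed.

Definition bottom_row (u : {'GL_2(p)}) : K * K := (GLval u 1 0, GLval u 1 1).

(** The trace gives the upper left entry, and the determinant the upper right
    one. *)
Lemma card_trace_class_bottom_neq0 c d : c != 0 ->
  #|[pred u | trace_class u & bottom_row u == (c, d)]| = 1%N.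
Proof.
move=> c_neq0; pose a := t + t^-1 - d; pose b := (a * d - 1) / c.
have det1 : a * d - b * c = 1 by rewrite /b; field.
rewrite -[RHS](card1 (SL2_of a b c d)); apply: eq_card => u; rewrite !inE /=.
rewrite trace_classE xpair_eqE; apply/idP/eqP=> [| ->]; last first.
  by rewrite GLval_SL2_of // !mxE /= det1 !eqxx /a subrK eqxx.
case/andP=> /andP[/eqP det /eqP tr] /andP[/eqP c_eq /eqP d_eq].
have aE : GLval u 0 0 = a by rewrite /a -tr d_eq addrK.
apply: GLval_inj; rewrite GLval_SL2_of // [LHS]mx22E c_eq d_eq aE.
congr mx22; rewrite /b -aE; move: det; rewrite c_eq d_eq => <-.
by field.
Qed.

(** With bottom row (0, d), trace and determinant force (t + 1/t - d) d = 1, and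
    the upper right entry is free. *)
Lemma card_trace_class_bottom0 d :
  #|[pred u | trace_class u & bottom_row u == (0, d)]|
    = (p * ((t + t^-1 - d) * d == 1)%R)%N.
Proof.
set a := t + t^-1 - d; have [ad1 | ad1] := eqVneq (a * d) 1; last first.
  rewrite /= muln0; apply: eq_card0 => u.
  rewrite !inE /= trace_classE xpair_eqE.
  apply: contraNF ad1 => /andP[/andP[/eqP det /eqP tr] /andP[/eqP c0 /eqP dE]].
  by rewrite /a -tr dE addrK -det c0 dE mulr0 subr0.
have det1 b : a * d - b * 0 = 1 by rewrite mulr0 subr0.
have inj : injective (fun b => SL2_of a b 0 d).
  by move=> b b' /(congr1 (@GLval 2 _)); rewrite !GLval_SL2_of // => /mx22_eq[].
rewrite /= muln1 -[RHS](card_Fp hp) -(card_image inj); apply: eq_card => u.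
rewrite !inE /= trace_classE xpair_eqE.
apply/idP/imageP=> [|[b _ ->]]; last first.
  by rewrite GLval_SL2_of // !mxE /= det1 !eqxx /a subrK eqxx.
case/andP=> /andP[_ /eqP tr] /andP[/eqP c_eq /eqP d_eq].
exists (GLval u 0 1) => //; apply: GLval_inj.
rewrite GLval_SL2_of // [LHS]mx22E c_eq d_eq.
by congr mx22; rewrite /a -tr d_eq addrK.
Qed.

(** The class sum acts as a scalar on the principal series.  Grouping the u by
    bottom row: the rows (0, t) and (0, 1/t) occur p times each and contribute
    p (omega + 1/omega) times the value at w; the rows with nonzero first entry
    occur once each, so that their contribution is multiplied by omega when all
    rows are scaled by t, and vanishes. *)
Lemma sum_trace_class w : w \in SL2 p ->
  \sum_(u | trace_class u) bottom_phi (u * w)%g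
    = p%:R * (omega + omega^-1) * bottom_phi w.
Proof.
move=> wS.
pose Phi c d := phi (c * GLval w 0 0 + d * GLval w 1 0)
                    (c * GLval w 0 1 + d * GLval w 1 1).
have Phi_scale k c d : k != 0 -> Phi (k * c) (k * d) = chi k * Phi c d.
  by move=> k_neq0; rewrite /Phi -!mulrA -!mulrDr phi_scale.
have PhiE u : bottom_phi (u * w)%g = Phi (bottom_row u).1 (bottom_row u).2.
  by rewrite /bottom_phi GL_ME [GLval u]mx22E [GLval w in LHS]mx22E mx22M !mxE.
have t_neq0 : t != 0 by apply: primitive_root_neq0 prim_t.
have -> : \sum_(u | trace_class u) bottom_phi (u * w)%g
    = \sum_(r : K * K) Phi r.1 r.2
        *+ #|[pred u | trace_class u & bottom_row u == r]|.
  rewrite (partition_big bottom_row predT) //=; apply: eq_bigr => r _.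
  rewrite -sumr_const; apply: eq_bigr => u /andP[_ /eqP ur].
  by rewrite PhiE ur.
rewrite (bigID (fun r : K * K => r.1 == 0)) /= addrC.
rewrite [X in X + _](_ : _ = 0) ?add0r.
  rewrite (reindex_onto (fun d : K => (0, d)) snd) /=; last first.
    by move=> [c d] /= /eqP ->.
  rewrite (eq_bigl predT) => [|d]; last by rewrite !eqxx.
  have t_neq_tV : t != t^-1.
    rewrite -(inj_eq (mulfI t_neq0)) divff // -expr2 -(prim_order_dvd prim_t).
    by apply/negP=> /dvdn_leq; lia.
  rewrite (bigD1 t) //= (bigD1 t^-1) 1?eq_sym //= big1 => [|d /andP[d_t d_tV]].
    rewrite !card_trace_class_bottom0 addrAC subrr add0r addrK mulVf //.
    rewrite divff // eqxx muln1.
    have Phi0 d : d != 0 -> Phi 0 d = chi d * bottom_phi w.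
      move=> d_neq0; rewrite -{1}[d]mulr1 -{1}(mulr0 d) Phi_scale //.
      by rewrite /Phi !mul0r !mul1r !add0r.
    rewrite addr0 !Phi0 ?invr_eq0 // chi_t chi_tV -mulrnDl -mulrDl.
    by rewrite -mulrA mulr_natl.
  rewrite card_trace_class_bottom0 (_ : _ == 1 = false) ?muln0 //.
  apply/negP=> /eqP eq1; have : (d - t) * (d - t^-1) = 0.
    by rewrite -(subrr 1) -{2}eq1; field.
  by move/eqP; rewrite mulf_eq0 !subr_eq0 (negPf d_t) (negPf d_tV).
set Z := LHS; have Z_scale : omega * Z = Z.
  pose scale (r : K * K) := (t * r.1, t * r.2).
  rewrite {2}/Z (reindex_inj (h := scale)) /=; last first.
    move=> [c d] [c' d'] /eqP; rewrite xpair_eqE !(inj_eq (mulfI t_neq0)).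
    by case/andP=> /eqP /= -> /eqP /= ->.
  rewrite big_distrr /=; apply: eq_big => [[c d] | [c d] /= c_neq0].
    by rewrite /= mulf_eq0 negb_or t_neq0.
  rewrite Phi_scale // chi_t !card_trace_class_bottom_neq0 ?mulr1n //.
  by rewrite mulf_neq0.
have : (omega - 1) * Z = 0 by rewrite mulrBl Z_scale mul1r subrr.
move/eqP; rewrite mulf_eq0 => /orP[| /eqP //].
rewrite subr_eq0 -[omega]expr1 -(prim_order_dvd prim_omega) dvdn1 => /eqP N1.
by have := half_predK; rewrite N1; lia.
Qed.

Lemma bottom_phi_shift u : bottom_phi (u * SL2x p)%g = zeta * bottom_phi u.
Proof.
rewrite /bottom_phi GL_ME -phi_shift.
by rewrite {1 2}[GLval u]mx22E mx22M !mxE /=; congr phi; ring.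
Qed.

(** As the trace class is invariant under conjugation, its sum may be moved to
    the left of g, where it acts on bottom rows. *)
Lemma psl_phi_eigen g :
  \sum_(u | trace_class u) psl_phi (g * PSL2_coset (u * SL2x p))%g
    = p%:R * (omega + omega^-1) * zeta * psl_phi g.
Proof.
have [w wS ->] := PSL2_cosetP g.
transitivity (zeta * \sum_(u | trace_class u) bottom_phi (w * u)%g).
  rewrite big_distrr /=; apply: eq_bigr => u /andP[uS _].
  have uxS : (u * SL2x p)%g \in SL2 p by rewrite groupM // SL2x_in.
  rewrite -PSL2_cosetM // psl_phi_coset ?(groupM wS uxS) //.
  by rewrite mulgA bottom_phi_shift.
rewrite (reindex_inj (conjg_inj w)) /=.
rewrite (eq_big trace_class (fun u => bottom_phi (u * w)%g)); last 2 first.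
- by move=> u; rewrite trace_classJ.
- by move=> u _; rewrite -conjgC.
by rewrite sum_trace_class // psl_phi_coset // mulrCA !mulrA.
Qed.

Lemma psl_phi_neq0 : exists g, psl_phi g != 0.
Proof.
exists (PSL2_coset (SL2y p)); rewrite psl_phi_coset ?SL2y_in //.
rewrite /bottom_phi /= !mxE /=.
rewrite /phi oner_eq0 mulf_neq0 ?chi_neq0 // expf_neq0 //.
exact: primitive_root_neq0 prim_zeta.
Qed.

End PrincipalSeries.

(** * The degree of the eigenvalue *)

Lemma coprime_addr_pow2 k e : odd k -> coprime k (k + 2 ^ e).
Proof.
by move=> k_odd; rewrite /coprime gcdnDl -/(coprime _ _) coprimeXr ?coprimen2.
Qed.

(** Equivalently, N has at least six units modulo N.  The witnesses are 1, 2, 4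
    for N odd; 1, Q - 4, Q - 2 for N = 2 Q with Q odd; 1, r - 2, r + 2 for
    N = 4 r with r odd; and 1, r - 1, r + 1 for N = 4 r with r even. *)
Lemma coprime_half_units N : (9 <= N)%N -> N != 10 -> N != 12 ->
  exists ks : seq nat,
  [/\ size ks = 3, uniq ks & all (fun k => coprime k N && (2 * k < N)%N) ks].
Proof.
move=> N_ge9 N_neq10 N_neq12.
have co_pow2 k e Q : odd k -> coprime k Q -> coprime k (2 ^ e * Q).
  by move=> k_odd kQ; rewrite coprimeMr kQ andbT coprimeXr ?coprimen2.
have [N_odd | /negbTE N_even] := boolP (odd N).
  exists [:: 1; 2; 4]; split=> //=; rewrite coprime1n coprime2n N_odd.
  have co4 : coprime (2 ^ 2) N by rewrite coprimeXl ?coprime2n.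
  by rewrite [coprime 4 N]co4 /=; lia.
have [Q NE] : exists Q, N = (2 * Q)%N by exists N./2; lia.
have [Q_odd | /negbTE Q_even] := boolP (odd Q).
  exists [:: 1; Q - 4; Q - 2]%N; split=> //=.
    by rewrite !inE; lia.
  rewrite coprime1n NE !(co_pow2 _ 1) ?oddB //=; try lia.
    have {2}-> : Q = (Q - 2 + 2 ^ 1)%N by lia.
    by apply: coprime_addr_pow2; lia.
  have {2}-> : Q = (Q - 4 + 2 ^ 2)%N by lia.
  by apply: coprime_addr_pow2; lia.
have [r QE] : exists r, Q = (2 * r)%N by exists Q./2; lia.
have [r_odd | /negbTE r_even] := boolP (odd r).
  have NE4 : N = (2 ^ 2 * r)%N by lia.
  exists [:: 1; r - 2; r + 2]%N; split=> //=.
    by rewrite !inE; lia.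
  rewrite coprime1n NE4 !co_pow2 //=; try lia.
    by rewrite coprime_sym (coprime_addr_pow2 1).
  have {2}-> : r = (r - 2 + 2 ^ 1)%N by lia.
  by apply: coprime_addr_pow2; lia.
have NE4 : N = (2 ^ 2 * r)%N by lia.
exists [:: 1; r - 1; r + 1]%N; split=> //=.
  by rewrite !inE; lia.
rewrite coprime1n NE4 !co_pow2 //=; try lia.
  by rewrite coprime_sym addn1 coprimenS.
by rewrite coprime_sym subn1 coprimenP //; lia.
Qed.

Section EigenvalueDegree.

Variables (p N : nat) (omega zeta : algC).
Hypothesis hp : prime p.
Hypothesis p_odd : odd p.
Hypothesis N_gt4 : (4 < N < p)%N.
Hypothesis prim_omega : N.-primitive_root omega.
Hypothesis prim_zeta : p.-primitive_root zeta.

Let mu k l := p%:R * (omega ^+ k + omega ^- k) * zeta ^+ l.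

Lemma coprime_N_p : coprime N p.
Proof.
rewrite coprime_sym prime_coprime //; apply/negP=> /dvdn_leq.
by case/andP: N_gt4; lia.
Qed.

Lemma omega_neq0 : omega != 0.
Proof. exact: primitive_root_neq0 prim_omega. Qed.

Lemma zeta_neq0 : zeta != 0.
Proof. exact: primitive_root_neq0 prim_zeta. Qed.

Lemma omega_expNp : omega ^+ (N * p) = 1.
Proof. by rewrite exprM (prim_expr_order prim_omega) expr1n. Qed.

Lemma zeta_expNp : zeta ^+ (N * p) = 1.
Proof. by rewrite mulnC exprM (prim_expr_order prim_zeta) expr1n. Qed.

(** The Chinese remainder theorem gives an automorphism raising omega to the
    power k and zeta to the power l. *)
Lemma mu_conjugate k l : coprime k N -> coprime l p ->
  root (minCpoly (mu 1 1)) (mu k l).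
Proof.
move=> kN lp; pose m := chinese N p k l.
have mN : m = k %[mod N] by apply: chinese_modl coprime_N_p _ _.
have mp : m = l %[mod p] by apply: chinese_modr coprime_N_p _ _.
have co : coprime m (N * p).
  rewrite coprimeMr -coprime_modl mN coprime_modl kN.
  by rewrite -coprime_modl mp coprime_modl.
have [u uE] := Qn_aut_exists co; rewrite -(minCpoly_aut u).
suff -> : mu k l = u (mu 1 1) by apply: root_minCpoly.
rewrite /mu !rmorphM rmorphD fmorphV !expr1 rmorph_nat.
rewrite (uE _ omega_expNp) (uE _ zeta_expNp) -(prim_expr_mod prim_omega m) mN.
by rewrite -(prim_expr_mod prim_zeta m) mp !prim_expr_mod.
Qed.

(** Otherwise omega^k would have order dividing 4. *)
Lemma real_part_neq0 k : coprime k N -> omega ^+ k + omega ^- k != 0.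
Proof.
move=> kN; apply/eqP=> sum0; have ok_neq0 := expf_neq0 k omega_neq0.
have sq : (omega ^+ k) ^+ 2 = -1.
  apply/eqP; rewrite -addr_eq0; apply/eqP.
  by rewrite -[RHS](mulr0 (omega ^+ k)) -sum0 mulrDr mulfV.
have : omega ^+ (k * 4) == 1 by rewrite exprM (exprM _ 2 2) sq sqrrN expr1n.
rewrite -(prim_order_dvd prim_omega) Gauss_dvdr 1?coprime_sym // => /dvdn_leq.
by case/andP: N_gt4; lia.
Qed.

(** The automorphism inverting omega and zeta fixes the factor
    omega^k + omega^-k and inverts the factor zeta^l.  Comparing an equality of
    two values with its image gives zeta^(2 l) = zeta^(2 l'), whence l = l';
    then omega^k + omega^-k determines k up to sign modulo N. *)
Lemma mu_inj k l k' l' : coprime k N -> coprime k' N ->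
    (2 * k < N)%N -> (2 * k' < N)%N -> (0 < l < p)%N -> (0 < l' < p)%N ->
  mu k l = mu k' l' -> k = k' /\ l = l'.
Proof.
move=> kN k'N ltk ltk' /andP[l_gt0 ltl] /andP[l'_gt0 ltl'].
have p_neq0 : p%:R != 0 :> algC by rewrite pnatr_eq0 -lt0n prime_gt0.
rewrite /mu -!mulrA => /(mulfI p_neq0).
set A := omega ^+ k + _; set A' := omega ^+ k' + _ => eq1.
have A_neq0 : A != 0 by apply: real_part_neq0.
have A'_neq0 : A' != 0 by apply: real_part_neq0.
have Np_gt0 : (0 < N * p)%N.
  by rewrite muln_gt0 (prime_gt0 hp) andbT; case/andP: N_gt4; lia.
have co : coprime (N * p).-1 (N * p) by rewrite coprime_sym coprimenP.
have [u uE] := Qn_aut_exists co.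
have uV (z : algC) : z ^+ (N * p) = 1 -> u z = z^-1.
  move=> zNp; have z_neq0 : z != 0.
    apply: contra_eq_neq zNp => ->.
    by rewrite expr0n gtn_eqF //= eq_sym oner_neq0.
  by apply: (mulfI z_neq0); rewrite uE // -exprS prednK // zNp mulfV.
have uo := uV _ omega_expNp; have uz := uV _ zeta_expNp.
have uA j : u (omega ^+ j + omega ^- j) = omega ^+ j + omega ^- j.
  by rewrite rmorphD fmorphV !rmorphXn uo exprVn invrK addrC.
have eq2 : A * zeta ^- l = A' * zeta ^- l'.
  have := congr1 u eq1; rewrite !rmorphM /A /A' !uA !rmorphXn uz.
  by rewrite !exprVn.
have zl_neq0 j : zeta ^+ j != 0 by rewrite expf_neq0 // zeta_neq0.
have eq_ll' : l = l'.
  have : zeta ^+ (l * 2) == zeta ^+ (l' * 2).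
    have : A * A' * (zeta ^+ l / zeta ^+ l')
        = A * A' * (zeta ^+ l' / zeta ^+ l).
      by rewrite mulrACA eq1 -eq2; ring.
    move/(mulfI (mulf_neq0 A_neq0 A'_neq0)) => /eqP.
    by rewrite eqr_div // !exprM !expr2.
  rewrite (eq_prim_root_expr prim_zeta) ![(_ * 2)%N]mulnC.
  have co2 : coprime 2 p by rewrite coprime2n.
  wlog: l l' ltl ltl' {l_gt0 l'_gt0 eq1 eq2} / (l <= l')%N => [hw|le].
    case/orP: (leq_total l l') => le; first exact: hw.
    by rewrite eq_sym => eq_l; apply/esym; move: eq_l; apply: hw.
  rewrite eq_sym eqn_mod_dvd ?leq_mul2l // -mulnBr Gauss_dvdr 1?coprime_sym //.
  have [/eqP d0 _ | d_gt0 /(dvdn_leq d_gt0)] := posnP (l' - l); last lia.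
  by move: d0; lia.
split=> //; move: eq1; rewrite eq_ll' => /(mulIf (zl_neq0 _)) eqA.
have := omega_neq0 => o_neq0.
have : (omega ^+ k - omega ^+ k') * (omega ^+ (k + k') - 1) = 0.
  have -> : (omega ^+ k - omega ^+ k') * (omega ^+ (k + k') - 1)
      = omega ^+ k * omega ^+ k' * (A - A').
    rewrite /A /A' exprD; field.
    by rewrite !expf_neq0.
  by rewrite eqA subrr mulr0.
move/eqP; rewrite mulf_eq0 !subr_eq0 => /orP[].
  rewrite (eq_prim_root_expr prim_omega) => /eqP.
  by rewrite !modn_small //; lia.
rewrite -(prim_order_dvd prim_omega) => /dvdn_leq.
have [k0|k_gt0] := posnP (k + k'); last by move=> /(_ isT); lia.
by lia.
Qed.

Lemma size_minCpoly_mu (ks : seq nat) : uniq ks ->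
    all (fun k => coprime k N && (2 * k < N)%N) ks ->
  (size ks * p.-1 < size (minCpoly (mu 1 1)))%N.
Proof.
move=> uniq_ks /allP good.
rewrite -[p.-1](size_iota 1) -(size_allpairs mu).
apply: max_poly_roots; first by rewrite minCpoly_eq0.
  apply/allP=> _ /allpairsP[[k l] /= [/good/andP[kN _] + ->]].
  rewrite mem_iota => l_bnd; apply: mu_conjugate => //.
  rewrite coprime_sym prime_coprime //; apply/negP=> /dvdn_leq.
  by have := prime_gt0 hp; move: l_bnd; lia.
apply: allpairs_uniq => //; first exact: iota_uniq.
move=> [k l] [k' l'] /allpairsP[[k1 l1] /= [/good/andP[kN ltk] + [-> ->]]].
move=> + /allpairsP[[k2 l2] /= [/good/andP[k'N ltk'] + [-> ->]]].
have bnd j : j \in iota 1 p.-1 -> (0 < j < p)%N.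
  by rewrite mem_iota add1n prednK ?(prime_gt0 hp).
move=> /bnd l1_bnd /bnd l2_bnd eq_mu.
by have [-> ->] := mu_inj kN k'N ltk ltk' l1_bnd l2_bnd eq_mu.
Qed.

End EigenvalueDegree.

(** * The Cayley graph of PSL(2, p) *)

Theorem mainTheorem10 (p : nat) (hp : prime p) (hp19 : (19 <= p)%N) :
  let Delta : {set PSL2 p} :=
    [set PSL2_coset (SL2x p); PSL2_coset (SL2y p)] in
  (<<Delta>> = [set: PSL2 p])%g /\ cerny_cayley_graph Delta.
Proof.
move=> Delta; split; first exact: PSL2_generated.
have p_gt3 : (3 < p)%N by apply: leq_trans hp19.
have N2 := half_predK hp p_gt3.
have p_odd : odd p by case: (even_prime hp) hp19 => [->|].
have [t prim_t] := Fp_primitive_root hp.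
have [omega prim_omega] : {z : algC | (p.-1./2).-primitive_root z}.
  by apply: C_prim_root_exists; lia.
have [zeta prim_zeta] := C_prim_root_exists (prime_gt0 hp).
have [ks [size_ks uniq_ks good_ks]] : exists ks : seq nat,
    [/\ size ks = 3, uniq ks
      & all (fun k => coprime k p.-1./2 && (2 * k < p.-1./2)%N) ks].
  (* The excluded orders 10 and 12 correspond to p = 21 and p = 25. *)
  apply: coprime_half_units; first lia.
    by apply: contraL hp => /eqP e; rewrite (_ : p = 21) //; lia.
  by apply: contraL hp => /eqP e; rewrite (_ : p = 25) //; lia.
have N_bnd : (4 < p.-1./2 < p)%N by lia.
have := size_minCpoly_mu hp p_odd N_bnd prim_omega prim_zeta uniq_ks good_ks.
rewrite size_ks !expr1 => big_degree.
apply: (@cerny_of_eigenvalue _ Delta (3 * p.-1) _ (trace_class t)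
  (fun u => PSL2_coset (u * SL2x p)%g) (p%:R * (omega + omega^-1) * zeta)
  (psl_phi t omega zeta)).
- exact: PSL2_words.
- by rewrite big_degree andbT; lia.
- exact: psl_phi_neq0.
exact: psl_phi_eigen.
Qed.
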